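(* Let $L,S>0$, $\Omega=(0,L)\times(0,S)\subset\mathbb{R}^2$, and $\overline{\Omega}=[0,L]\times[0,S]$. Let $\phi_1,\phi_2:\overline{\Omega}\to(0,\infty)$, $\lambda,R:\overline{\Omega}\to[0,\infty)$, $K_1,K_2:\overline{\Omega}\to[0,\infty)$ and $f_1,f_2:\overline{\Omega}\to(0,\infty)$ be continuous functions. Consider the weakly coupled system of eikonal equations $$|\nabla u_1|\,f_1+\phi_1(u_1-u_2)=K_1+\lambda R,\qquad |\nabla u_2|\,f_2+\phi_2(u_2-u_1)=K_2+\phi_2R\qquad\text{in }\Omega,$$ and let $$\mathcal{A}=\{x\in\overline{\Omega}: K_1(x)+\lambda(x)R(x)=0\}\cap\{x\in\overline{\Omega}: K_2(x)+\phi_2(x)R(x)=0\}.$$ Let $u=(u_1,u_2):\overline{\Omega}\to\mathbb{R}^2$ be bounded and upper semicontinuous (componentwise) and a viscosity subsolution of the system in $\Omega$, and let $v=(v_1,v_2):\overline{\Omega}\to\mathbb{R}^2$ be bounded and lower semicontinuous (componentwise) and a viscosity supersolution of the system in $\Omega$. Assume that $u_i(x)\le v_i(x)$ for every $x\in\mathcal{A}\cup\partial\Omega$ and $i=1,2$. Then $u_i(x)\le v_i(x)$ for every $x\in\overline{\Omega}$ and $i=1,2$.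
   Context: Viscosity subsolution: $u=(u_1,u_2)$, with upper semicontinuous components, is a viscosity subsolution of the system in $\Omega$ if for each $i\in\{1,2\}$, each $\varphi\in C^1(\Omega)$ and each $x\in\Omega$ at which $u_i-\varphi$ attains a local maximum, the $i$-th of the following inequalities holds at $x$: $$(i=1)\quad |\nabla\varphi(x)|f_1(x)+\phi_1(x)u_1(x)\le K_1(x)+\lambda(x)R(x)+\phi_1(x)u_2(x),$$ $$(i=2)\quad |\nabla\varphi(x)|f_2(x)+\phi_2(x)u_2(x)\le K_2(x)+\phi_2(x)R(x)+\phi_2(x)u_1(x).$$ Viscosity supersolution: $v=(v_1,v_2)$, with lower semicontinuous components, is a viscosity supersolution of the system in $\Omega$ if for each $i\in\{1,2\}$, each $\varphi\in C^1(\Omega)$ and each $x\in\Omega$ at which $v_i-\varphi$ attains a local minimum, the $i$-th of the following inequalities holds at $x$: $$(i=1)\quad |\nabla\varphi(x)|f_1(x)+\phi_1(x)v_1(x)\ge K_1(x)+\lambda(x)R(x)+\phi_1(x)v_2(x),$$ $$(i=2)\quad |\nabla\varphi(x)|f_2(x)+\phi_2(x)v_2(x)\ge K_2(x)+\phi_2(x)R(x)+\phi_2(x)v_1(x).$$ Inequalities between vector-valued functions are understood componentwise. The set $\mathcal{A}$ is called the Aubry set of the system. $|\cdot|$ is the Euclidean norm. *)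

(* Defs.v *)
From HB Require Import structures.
From mathcomp Require Import all_boot all_order all_algebra.
From mathcomp Require Import all_classical all_reals all_analysis.

Set Implicit Arguments.
Unset Strict Implicit.
Unset Printing Implicit Defensive.

Import Order.TTheory GRing.Theory Num.Theory.
Import numFieldNormedType.Exports.

Local Open Scope classical_set_scope.
Local Open Scope ring_scope.

(* Functions on a set D of the plane are total functions R * R -> R that are
   only constrained on D.  The plane R * R carries the product topology; the
   library's norm on it is the sup norm, so the Euclidean length of the
   gradient is written out. *)

(* [subspace D] makes points outside D isolated, so the condition is vacuous
   there: this is semicontinuity of the restriction of f to D. *)
Definition lsc_on (R : realType) (D : set (R * R)) (f : R * R -> R) : Prop :=
  lower_semicontinuous (fun x : subspace D => (f x)%:E).

Definition usc_on (R : realType) (D : set (R * R)) (f : R * R -> R) : Prop :=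
  lsc_on D (fun x => - f x).

Definition boundary (R : realType) (D : set (R * R)) : set (R * R) :=
  closure D `\` interior D.

Definition dx1 (R : realType) (g : R * R -> R) (x : R * R) : R :=
  'D_((1, 0) : R * R) g x.

Definition dx2 (R : realType) (g : R * R -> R) (x : R * R) : R :=
  'D_((0, 1) : R * R) g x.

Definition grad_norm (R : realType) (g : R * R -> R) (x : R * R) : R :=
  Num.sqrt (dx1 g x ^+ 2 + dx2 g x ^+ 2).

(* Meant for an open set U. *)
Definition C1_on (R : realType) (U : set (R * R)) (g : R * R -> R) : Prop :=
  [/\ forall x, U x -> differentiable g x,
      {within U, continuous (dx1 g)} &
      {within U, continuous (dx2 g)}].

Definition local_max (R : realType) (g : R * R -> R) (x : R * R) : Prop :=
  \forall y \near x, g y <= g x.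

Definition local_min (R : realType) (g : R * R -> R) (x : R * R) : Prop :=
  \forall y \near x, g x <= g y.

Definition open_rect (R : realType) (L S : R) : set (R * R) :=
  `]0, L[ `*` `]0, S[.

Definition closed_rect (R : realType) (L S : R) : set (R * R) :=
  `[0, L] `*` `[0, S].

Definition viscosity_subsolution (R : realType) (Omega : set (R * R))
    (f1 f2 phi1 phi2 lambda rho K1 K2 u1 u2 : R * R -> R) : Prop :=
  [/\ usc_on Omega u1, usc_on Omega u2,
      (forall g, C1_on Omega g -> forall x, Omega x ->
        local_max (fun y => u1 y - g y) x ->
        grad_norm g x * f1 x + phi1 x * u1 x
          <= K1 x + lambda x * rho x + phi1 x * u2 x) &
      (forall g, C1_on Omega g -> forall x, Omega x ->
        local_max (fun y => u2 y - g y) x ->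
        grad_norm g x * f2 x + phi2 x * u2 x
          <= K2 x + phi2 x * rho x + phi2 x * u1 x)].

Definition viscosity_supersolution (R : realType) (Omega : set (R * R))
    (f1 f2 phi1 phi2 lambda rho K1 K2 v1 v2 : R * R -> R) : Prop :=
  [/\ lsc_on Omega v1, lsc_on Omega v2,
      (forall g, C1_on Omega g -> forall x, Omega x ->
        local_min (fun y => v1 y - g y) x ->
        K1 x + lambda x * rho x + phi1 x * v2 x
          <= grad_norm g x * f1 x + phi1 x * v1 x) &
      (forall g, C1_on Omega g -> forall x, Omega x ->
        local_min (fun y => v2 y - g y) x ->
        K2 x + phi2 x * rho x + phi2 x * v1 x
          <= grad_norm g x * f2 x + phi2 x * v2 x)].

Definition aubry_set (R : realType) (D : set (R * R))
    (phi2 lambda rho K1 K2 : R * R -> R) : set (R * R) :=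
  [set x | D x /\ K1 x + lambda x * rho x = 0] `&`
  [set x | D x /\ K2 x + phi2 x * rho x = 0].

(* Main.v *)
Require Import Defs.
From HB Require Import structures.
From mathcomp Require Import all_boot all_order all_algebra.
From mathcomp Require Import all_classical all_reals all_analysis.
From mathcomp Require Import ring lra.
Import Order.TTheory GRing.Theory Num.Theory.
Import numFieldNormedType.Exports.
Local Open Scope classical_set_scope.
Local Open Scope ring_scope.

(** Dividing the i-th equation by f_i puts the system in the form
    |Du_i| + c_i (u_i - u_j) = g_i with c_i > 0 and g_i >= 0, and the Aubry set
    is the set where g_1 and g_2 both vanish.  The system is positively
    homogeneous in (u, g), so for 0 < th < 1 the functions th u_i satisfy the
    subsolution inequalities with the smaller right-hand sides th g_i, which are
    strict wherever g_i > 0.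

    Put w_i = th u_i - v_i and let x0 be an interior point where some w_i
    attains the largest value M taken by either of w_1, w_2.  Comparing the two
    viscosity inequalities at x0 ([coupling_at_max]) gives
      c_i (M - w_j) + (1 - th) g_i <= 0  at x0.
    Both terms are nonnegative, hence g_i (x0) = 0, and also w_j (x0) = M.  So x0
    is a maximum point of w_j too, and the same inequality for j gives
    g_j (x0) = 0 ([sources_vanish_at_max]).  Off the Aubry set one of the two
    sources may still vanish, so a single equation gives no contradiction there:
    the coupling carries the maximum over to the other component.  Thus M is
    attained on the Aubry set or on
    the boundary, where u_i <= v_i and therefore w_i <= (1 - th) sup |u_i|.
    If u_i > v_i at some point, taking th close to 1 contradicts this.

    The comparison at x0 doubles the variables ([doubling_variables]):
      U x - V y - n |x - y|^2 - |x - x0|^2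
    has maximum points (x, y) arbitrarily close to (x0, x0), at which the
    penalty supplies the test functions for U = u_i and V = v_i / th.  Since the
    gradient carries no weight after the division by f_i, the two gradient
    norms, which may be large with n, enter only through their difference, and
    this is bounded by a multiple of |x - x0| ([grad_norm_quad_le]). *)

(** * Upper semicontinuity on a subset *)

(** The restriction of f to K is upper semicontinuous, phrased with
    neighbourhoods of the ambient space, so that it composes with the
    projections of a product and meets the covering form of compactness. *)
Definition usc_within {T : topologicalType} {R : realType} (K : set T)
    (f : T -> R) : Prop :=
  forall x a, K x -> f x < a -> \forall y \near x, K y -> f y < a.

Lemma usc_on_within (R : realType) (K : set (R * R)) (f : R * R -> R) :
  usc_on K f -> usc_within K f.
Proof.
move=> uf x a Kx fxa.
have [|V Vx Vf] := uf x (- a); first by rewrite lte_fin ltrN2.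
move: Vx; rewrite /nbhs/= -nbhs_subspace_in// => Vx.
apply: (@filterS _ _ _ (fun y => K y -> V y)) Vx => y Vy Ky; have := Vf _ (Vy Ky).
by rewrite lte_fin ltrN2.
Qed.

Lemma lsc_on_within (R : realType) (K : set (R * R)) (f : R * R -> R) :
  lsc_on K f -> usc_within K (fun x => - f x).
Proof.
move=> lf; apply: usc_on_within.
by rewrite /usc_on (_ : (fun x => - - f x) = f)//; apply/funext => x; rewrite opprK.
Qed.

Lemma usc_withinD {T : topologicalType} {R : realType} (K : set T)
    (f g : T -> R) :
  usc_within K f -> usc_within K g -> usc_within K (fun x => f x + g x).
Proof.
move=> uf ug x a Kx fga; pose e := (a - (f x + g x)) / 2.
have e0 : 0 < e by rewrite divr_gt0// subr_gt0.
have fe : f x < f x + e by rewrite ltrDl.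
have ge : g x < g x + e by rewrite ltrDl.
near=> y => Ky.
have hf : f y < f x + e by move: Ky; near: y; exact: uf.
have hg : g y < g x + e by move: Ky; near: y; exact: ug.
by move: hf hg; rewrite /e; lra.
Unshelve. all: by end_near. Qed.

Lemma usc_withinZ {T : topologicalType} {R : realType} (K : set T)
    (k : R) (f : T -> R) :
  0 < k -> usc_within K f -> usc_within K (fun x => k * f x).
Proof.
move=> k0 uf x a Kx; rewrite mulrC -ltr_pdivlMr// => /(uf _ _ Kx).
by apply: filterS => y /[apply]; rewrite ltr_pdivlMr// mulrC.
Qed.

Lemma usc_within_continuous {T : topologicalType} {R : realType} (K : set T)
    (f : T -> R) :
  continuous f -> usc_within K f.
Proof.
move=> cf x a _ fxa.
by near=> y => _; near: y; exact: (cf x _ (lt_nbhsl fxa)).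
Unshelve. all: by end_near. Qed.

Lemma usc_within_comp {S T : topologicalType} {R : realType} (H : set S)
    (K : set T) (h : S -> T) (f : T -> R) :
  continuous h -> (forall x, H x -> K (h x)) -> usc_within K f ->
  usc_within H (fun x => f (h x)).
Proof.
move=> ch hHK uf x a Hx fhxa.
near=> y => /hHK; near: y; apply: (ch x (fun z => K z -> f z < a)).
by apply: uf => //; exact: hHK.
Unshelve. all: by end_near. Qed.

(** Otherwise the sets of points of K where f exceeds f x, for x in K, form a
    proper filter base.  Semicontinuity says that near each point of K, f stays
    below f i for i deep in this filter; compactness makes a single i work on
    all of K, including at i itself. *)
Lemma usc_within_max {T : topologicalType} {R : realType} (K : set T)
    (f : T -> R) :
  K !=set0 -> compact K -> usc_within K f ->
  exists2 x, K x & forall y, K y -> f y <= f x.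
Proof.
move=> [x0 Kx0] cK uf; apply: contrapT => nomax.
have better x : K x -> exists2 y, K y & f x < f y.
  move=> Kx; apply: contrapT => nb; apply: nomax; exists x => // y Ky.
  by rewrite leNgt; apply/negP => fxy; apply: nb; exists y.
pose F := filter_from K (fun x => [set y | K y /\ f x < f y]).
have FF : Filter F.
  apply: filter_from_filter; first by exists x0.
  move=> x y Kx Ky; have [fxy|/ltW fxy] := leP (f x) (f y).
    by exists y => // z [Kz yz]; split; split => //; exact: le_lt_trans yz.
  by exists x => // z [Kz yz]; split; split => //; exact: le_lt_trans yz.
have /(_ _ F (fun i x => f x < f i) FF) [] :=
  (near_covering_withinP K).2 ((compact_near_coveringP K).1 cK).
  move=> x Kx; have [y Ky xy] := better _ Kx.
  exists ([set x' | K x' -> f x' < f y], [set i | K i /\ f y < f i]).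
    by split; [exact: uf|exists y].
  by move=> [x' i]/= [hx' [_ yi]] /hx' /lt_trans; apply.
move=> x Kx xK; have [y Ky xy] := better _ Kx.
by have /(_ _ Ky) := xK y (conj Ky xy); rewrite /= ltxx.
Qed.

(** * Quadratic test functions *)

Definition sqdist {R : realType} (x y : R * R) : R :=
  (x.1 - y.1) ^+ 2 + (x.2 - y.2) ^+ 2.

Lemma sqdist_ge0 {R : realType} (x y : R * R) : 0 <= sqdist x y.
Proof. by rewrite addr_ge0// sqr_ge0. Qed.

Lemma sqdist_eq0 {R : realType} (x y : R * R) : (sqdist x y == 0) = (x == y).
Proof.
case: x y => [x1 x2] [y1 y2].
by rewrite paddr_eq0 ?sqr_ge0// !sqrf_eq0 !subr_eq0 xpair_eqE.
Qed.

Lemma sqdistC {R : realType} (x y : R * R) : sqdist x y = sqdist y x.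
Proof. by rewrite /sqdist; ring. Qed.

(** Both test functions produced by the doubling of variables have this form. *)
Definition quad {R : realType} (k : R) (a : R * R) (m : R) (b x : R * R) : R :=
  k * sqdist x a + m * sqdist x b.

Lemma fst_continuous (T T' : topologicalType) : continuous (@fst T T').
Proof. by move=> x; exact: cvg_fst. Qed.

Lemma snd_continuous (T T' : topologicalType) : continuous (@snd T T').
Proof. by move=> x; exact: cvg_snd. Qed.

Lemma differentiable_fst (R : realType) (x : R * R) :
  differentiable (fst : R * R -> R) x.
Proof. by apply: linear_differentiable; exact: fst_continuous. Qed.

Lemma differentiable_snd (R : realType) (x : R * R) :
  differentiable (snd : R * R -> R) x.
Proof. by apply: linear_differentiable; exact: snd_continuous. Qed.

Lemma is_derive_fst (R : realType) (x v : R * R) :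
  is_derive x v (fst : R * R -> R) v.1.
Proof.
apply: DeriveDef; first exact/diff_derivable/differentiable_fst.
rewrite deriveE ?diff_lin//; first exact: fst_continuous.
exact: differentiable_fst.
Qed.

Lemma is_derive_snd (R : realType) (x v : R * R) :
  is_derive x v (snd : R * R -> R) v.2.
Proof.
apply: DeriveDef; first exact/diff_derivable/differentiable_snd.
rewrite deriveE ?diff_lin//; first exact: snd_continuous.
exact: differentiable_snd.
Qed.

Lemma sqdistE (R : realType) (a : R * R) :
  sqdist^~ a = (fst - cst a.1) ^+ 2 + (snd - cst a.2) ^+ 2.
Proof. by []. Qed.

Lemma differentiable_sqdist (R : realType) (a x : R * R) :
  differentiable (sqdist^~ a) x.
Proof.
have f := @differentiable_fst R x; have s := @differentiable_snd R x.
by rewrite sqdistE; apply: differentiableD; apply: differentiableX;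
  apply: differentiableB.
Qed.

Lemma derive_sqdist (R : realType) (a x v : R * R) :
  'D_v (sqdist^~ a) x = 2 * (x.1 - a.1) * v.1 + 2 * (x.2 - a.2) * v.2.
Proof.
have f := @is_derive_fst R x v; have s := @is_derive_snd R x v.
rewrite sqdistE.
rewrite deriveD; [rewrite !derive_val|exact: ex_derive|exact: ex_derive].
rewrite /= /GRing.scale /= !fctE; ring.
Qed.

Lemma quadE (R : realType) (k m : R) (a b : R * R) :
  quad k a m b = k *: (sqdist^~ a) + m *: (sqdist^~ b).
Proof. by []. Qed.

Lemma differentiable_quad (R : realType) (k m : R) (a b x : R * R) :
  differentiable (quad k a m b) x.
Proof.
by rewrite quadE; apply: differentiableD; apply: differentiableZ;
  exact: differentiable_sqdist.
Qed.

Lemma derive_quad (R : realType) (k m : R) (a b x v : R * R) :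
  'D_v (quad k a m b) x =
  (2 * k * (x.1 - a.1) + 2 * m * (x.1 - b.1)) * v.1 +
  (2 * k * (x.2 - a.2) + 2 * m * (x.2 - b.2)) * v.2.
Proof.
have da := @diff_derivable _ _ _ _ _ v (differentiable_sqdist _ a x).
have db := @diff_derivable _ _ _ _ _ v (differentiable_sqdist _ b x).
rewrite quadE deriveD; [|exact: derivableZ|exact: derivableZ].
by rewrite !deriveZ// !derive_sqdist /GRing.scale /=; ring.
Qed.

Lemma dx1_quad (R : realType) (k m : R) (a b : R * R) :
  dx1 (quad k a m b) = fun x => 2 * k * (x.1 - a.1) + 2 * m * (x.1 - b.1).
Proof. by apply/funext => x; rewrite /dx1 derive_quad /= mulr1 mulr0 addr0. Qed.

Lemma dx2_quad (R : realType) (k m : R) (a b : R * R) :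
  dx2 (quad k a m b) = fun x => 2 * k * (x.2 - a.2) + 2 * m * (x.2 - b.2).
Proof. by apply/funext => x; rewrite /dx2 derive_quad /= mulr1 mulr0 add0r. Qed.

Lemma C1_on_quad (R : realType) (U : set (R * R)) (k m : R) (a b : R * R) :
  C1_on U (quad k a m b).
Proof.
split=> [x _||]; first exact: differentiable_quad.
- rewrite dx1_quad; apply: continuous_subspaceT => x.
  by apply: cvgD; (apply: cvgM; [exact: cvg_cst|]);
    (apply: cvgB; [exact: cvg_fst|exact: cvg_cst]).
- rewrite dx2_quad; apply: continuous_subspaceT => x.
  by apply: cvgD; (apply: cvgM; [exact: cvg_cst|]);
    (apply: cvgB; [exact: cvg_snd|exact: cvg_cst]).
Qed.

Lemma sqdist_continuous (R : realType) (f g : (R * R) * (R * R) -> R * R) :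
  continuous f -> continuous g -> continuous (fun z => sqdist (f z) (g z)).
Proof.
move=> cf cg z.
have c1 (h : (R * R) * (R * R) -> R * R) : continuous h ->
    {for z, continuous (fun z => (h z).1 : R)}.
  by move=> ch; apply: (cvg_comp h fst (ch z)); exact: fst_continuous.
have c2 (h : (R * R) * (R * R) -> R * R) : continuous h ->
    {for z, continuous (fun z => (h z).2 : R)}.
  by move=> ch; apply: (cvg_comp h snd (ch z)); exact: snd_continuous.
have sq (h : (R * R) * (R * R) -> R) : {for z, continuous h} ->
    {for z, continuous (fun z => h z ^+ 2)}.
  by move=> ch; apply: (cvg_comp h (fun t => t ^+ 2) ch); exact: exprn_continuous.
apply: cvgD; apply: sq; apply: cvgB; [exact: c1|exact: c1|exact: c2|exact: c2].
Qed.

(** * Doubling of variables *)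

(** The term |x - x0|^2 makes x0 a strict maximum point of the diagonal problem.
    Off any neighbourhood of (x0, x0) the penalized function is therefore, for
    n large, below its value M = U x0 - V x0 at (x0, x0): near a diagonal point
    other than (x0, x0) by semicontinuity, near an off-diagonal point because
    n |x - y|^2 is large there, and compactness makes n uniform.  As the value
    at the maximum is at least M, so is U x - V y. *)
Lemma doubling_variables (R : realType) (K Om : set (R * R))
    (U V : R * R -> R) (x0 : R * R) (P : (R * R) * (R * R) -> Prop) :
  compact K -> open Om -> Om `<=` K -> Om x0 ->
  usc_within K U -> usc_within K (fun x => - V x) ->
  (forall x, K x -> U x - V x <= U x0 - V x0) ->
  (\forall z \near (x0, x0), P z) ->
  exists n x y, [/\ Om x /\ Om y, P (x, y) & U x0 - V x0 <= U x - V y] /\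
    (local_max (fun z => U z - quad n y 1 x0 z) x /\
     local_min (fun z => V z - quad (- n) x 0 x z) y).
Proof.
move=> cK oOm OmK Omx0 uU lV max0 Px0; have Kx0 := OmK _ Omx0.
pose F (z : (R * R) * (R * R)) := U z.1 - V z.2 - sqdist z.1 x0.
have uF : usc_within (K `*` K) F.
  apply: usc_withinD; first apply: usc_withinD.
  - by apply: (usc_within_comp _ _ fst U _ _ uU) => [z|z []//]; exact: cvg_fst.
  - by apply: (usc_within_comp _ _ snd _ _ _ lV) => [z|z []//]; exact: cvg_snd.
  - apply: usc_within_continuous => z; apply: cvgN.
    by apply: sqdist_continuous => y; [exact: cvg_fst|exact: cvg_cst].
(* The target neighbourhood; K minus Om is excluded as well, so that both test
   functions touch at interior points. *)
pose W z := [/\ Om z.1, Om z.2 & P z].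
have Wx0 : \forall z \near (x0, x0), W z.
  near=> z; split; near: z => //.
  - apply: (@fst_continuous _ _ (x0, x0) Om); exact: open_nbhs_nbhs.
  - apply: (@snd_continuous _ _ (x0, x0) Om); exact: open_nbhs_nbhs.
have csq : continuous (fun z : (R * R) * (R * R) => sqdist z.1 z.2).
  by apply: sqdist_continuous; [exact: fst_continuous|exact: snd_continuous].
pose K2 := K `*` K; have cK2 : compact K2 by exact: compact_setX.
pose M := U x0 - V x0.
have far : \forall n \near +oo, K2 `<=` [set z | ~ W z ->
    F z - n * sqdist z.1 z.2 < M].
  apply: ((near_covering_withinP K2).2 ((compact_near_coveringP K2).1 cK2)).
  move=> z K2z; have [Kz1 Kz2] := K2z.
  have := sqdist_ge0 z.1 z.2; rewrite le_eqVlt => /predU1P[/esym/eqP|].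
    rewrite sqdist_eq0 => /eqP z12.
    have [z1x0|z1x0] := eqVneq z.1 x0.
      near=> z' n => /= _; case; near: z'.
      by rewrite (_ : z = (x0, x0))// [z]surjective_pairing -z12 z1x0.
    have FM : F z < M.
      have := max0 _ Kz1; rewrite /F -z12 /M.
      have : 0 < sqdist z.1 x0 by rewrite lt_def sqdist_eq0 z1x0 sqdist_ge0.
      lra.
    near=> z' n => /= K2z' _.
    have n0 : 0 <= n by near: n; exact: nbhs_pinfty_ge.
    have := mulr_ge0 n0 (sqdist_ge0 z'.1 z'.2).
    suff : F z' < M by lra.
    by move: K2z'; near: z'; exact: uF.
  set d := sqdist z.1 z.2 => d0.
  have dd : d / 2 < d by rewrite ltr_pdivrMr// ltr_pMr// ltr1n.
  near=> z' n => /= K2z' _.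
  have n0 : 0 <= n by near: n; exact: nbhs_pinfty_ge.
  have nd : (F z + 1 - M) / (d / 2) < n.
    by near: n; apply: nbhs_pinfty_gt; exact: num_real.
  rewrite ltr_pdivrMr ?divr_gt0// in nd.
  have : d / 2 < sqdist z'.1 z'.2.
    by near: z'; exact: (csq z _ (lt_nbhsr dd)).
  move=> /ltW/(ler_wpM2l n0).
  suff : F z' < F z + 1 by lra.
  by move: K2z'; near: z'; apply: uF => //; rewrite ltrDl.
have [n [n0 {}far]] := filter_ex (filterI (nbhs_pinfty_gt (num_real 0)) far).
pose G z := F z - n * sqdist z.1 z.2.
have uG : usc_within K2 G.
  apply: usc_withinD; first exact: uF.
  apply: usc_within_continuous => z; apply: cvgN; apply: cvgM; first exact: cvg_cst.
  exact: csq.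
have K20 : K2 !=set0 by exists (x0, x0).
have [[x y] /= Kxy Gmax] := usc_within_max _ _ K20 cK2 uG.
have sqdistxx (t : R * R) : sqdist t t = 0 by apply/eqP; rewrite sqdist_eq0.
have GM : M <= G (x, y).
  have := Gmax (x0, x0) (conj Kx0 Kx0).
  by rewrite {1}/G /F /= !sqdistxx mulr0 !subr0.
have [Omx Omy Pxy] : W (x, y).
  by apply: contrapT => /(far _ Kxy); rewrite ltNge GM.
have sq1 := sqdist_ge0 x x0.
have nsq : 0 <= n * sqdist x y by rewrite mulr_ge0// ?sqdist_ge0// ltW.
exists n, x, y; split; last split.
- by split=> //; move: GM; rewrite /G /F /M /=; lra.
- near=> z; have Kz : K z by apply: OmK; near: z; exact: open_nbhs_nbhs.
  by have := Gmax (z, y) (conj Kz Kxy.2); rewrite /G /F /quad /=; lra.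
- near=> z; have Kz : K z by apply: OmK; near: z; exact: open_nbhs_nbhs.
  have := Gmax (x, z) (conj Kxy.1 Kz); rewrite /G /F /quad /=.
  by rewrite (sqdistC z) (sqdistC y); lra.
Unshelve. all: by end_near. Qed.

(** * The scalar eikonal inequalities *)

(** A is an arbitrary function, so that it can hold the coupling term, which
    involves the other component and need not be continuous. *)
Definition eikonal_sub {R : realType} (Om : set (R * R)) (A u : R * R -> R) :=
  forall g, C1_on Om g -> forall x, Om x ->
    local_max (fun y => u y - g y) x -> grad_norm g x <= A x.

Definition eikonal_super {R : realType} (Om : set (R * R)) (B v : R * R -> R) :=
  forall g, C1_on Om g -> forall x, Om x ->
    local_min (fun y => v y - g y) x -> B x <= grad_norm g x.

Lemma eikonal_sub_normalized (R : realType) (Om : set (R * R))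
    (f phi h u w : R * R -> R) :
  (forall x, Om x -> 0 < f x) ->
  (forall g, C1_on Om g -> forall x, Om x -> local_max (fun y => u y - g y) x ->
    grad_norm g x * f x + phi x * u x <= h x + phi x * w x) ->
  eikonal_sub Om (fun x => h x / f x - phi x / f x * (u x - w x)) u.
Proof.
move=> f0 sub g Cg x Omx /(sub g Cg x Omx) le_h.
rewrite mulrAC -mulrBl ler_pdivlMr ?f0//; lra.
Qed.

Lemma eikonal_super_normalized (R : realType) (Om : set (R * R))
    (f phi h v w : R * R -> R) :
  (forall x, Om x -> 0 < f x) ->
  (forall g, C1_on Om g -> forall x, Om x -> local_min (fun y => v y - g y) x ->
    h x + phi x * w x <= grad_norm g x * f x + phi x * v x) ->
  eikonal_super Om (fun x => h x / f x - phi x / f x * (v x - w x)) v.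
Proof.
move=> f0 sup g Cg x Omx /(sup g Cg x Omx) ge_h.
rewrite mulrAC -mulrBl ler_pdivrMr ?f0//; lra.
Qed.

(** On squaring, the cross terms are bounded because |c| and |d| are at most the
    Euclidean norm of (c, d). *)
Lemma sqrt_sumsq_le (R : realType) (a b c d : R) :
  Num.sqrt (a ^+ 2 + b ^+ 2) <=
  Num.sqrt (c ^+ 2 + d ^+ 2) + (`|a - c| + `|b - d|).
Proof.
set N := Num.sqrt (c ^+ 2 + d ^+ 2).
have N2 : N ^+ 2 = c ^+ 2 + d ^+ 2 by rewrite sqr_sqrtr// addr_ge0// sqr_ge0.
have N0 : 0 <= N by exact: sqrtr_ge0.
have cN : `|c| <= N by rewrite -sqrtr_sqr ler_wsqrtr// lerDl sqr_ge0.
have dN : `|d| <= N by rewrite -sqrtr_sqr ler_wsqrtr// lerDr sqr_ge0.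
have cross e t : `|e| <= N -> e * t <= N * `|t|.
  move=> eN; apply: le_trans (ler_norm _) _; rewrite normrM.
  by rewrite ler_wpM2r.
have h1 := cross _ (a - c) cN; have h2 := cross _ (b - d) dN.
have p0 : 0 <= `|a - c| by []. have q0 : 0 <= `|b - d| by [].
have p2 : `|a - c| ^+ 2 = (a - c) ^+ 2 by rewrite real_normK ?num_real.
have q2 : `|b - d| ^+ 2 = (b - d) ^+ 2 by rewrite real_normK ?num_real.
have pq := mulr_ge0 p0 q0.
rewrite -(@ger0_norm _ (N + _)) ?addr_ge0// -sqrtr_sqr ler_wsqrtr//.
move: p2 q2 h1 h2 N2 pq; set p := `|a - c|; set q := `|b - d| => p2 q2 h1 h2 N2 pq.
nra.
Qed.

(** These are the gradients of the two test functions at a maximum point (x, y)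
    of the penalized function, the second one scaled by th because it is tested
    against v rather than v / th; they differ by the gradient of the
    localizing term |x - x0|^2. *)
Lemma grad_norm_quad_le (R : realType) (n th : R) (x y x0 : R * R) : 0 <= th ->
  grad_norm (quad (- (th * n)) x 0 x) y <=
  th * (grad_norm (quad n y 1 x0) x + 2 * (`|x.1 - x0.1| + `|x.2 - x0.2|)).
Proof.
move=> th0; rewrite /grad_norm !dx1_quad !dx2_quad.
rewrite (_ : _ + _ = th ^+ 2 *
  ((2 * n * (x.1 - y.1)) ^+ 2 + (2 * n * (x.2 - y.2)) ^+ 2)); last by ring.
rewrite sqrtrM ?sqr_ge0// sqrtr_sqr ger0_norm// ler_wpM2l//.
apply: le_trans (sqrt_sumsq_le _ _ _ (2 * n * (x.1 - y.1) + 2 * 1 * (x.1 - x0.1))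
  (2 * n * (x.2 - y.2) + 2 * 1 * (x.2 - x0.2))) _.
have shift (e t : R) : `|e - (e + 2 * t)| = 2 * `|t|.
  by rewrite opprD addrA subrr sub0r normrN normrM ger0_norm.
by rewrite lerD2l mulr1 !shift mulrDr.
Qed.

(** * Maximum points of the coupled problem *)

Lemma within_continuousM (R : realType) (K : set (R * R)) (f g : R * R -> R) :
  {within K, continuous f} -> {within K, continuous g} ->
  {within K, continuous (fun x => f x * g x)}.
Proof. by move=> cf cg x; apply: cvgM; [exact: cf|exact: cg]. Qed.

Lemma within_continuous_div (R : realType) (K : set (R * R)) (f g : R * R -> R) :
  {within K, continuous f} -> {within K, continuous g} ->
  (forall x, K x -> 0 < g x) ->
  {within K, continuous (fun x => f x / g x)}.
Proof.
move=> /subspace_continuousP cf /subspace_continuousP cg g0.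
apply/subspace_continuousP => x Kx; apply: cvgM; first exact: cf.
by apply: cvgV; [rewrite gt_eqF ?g0|exact: cg].
Qed.

Lemma within_open_continuous {R : realType} (K Om : set (R * R))
    (f : R * R -> R) (x : R * R) :
  open Om -> Om `<=` K -> Om x -> {within K, continuous f} ->
  {for x, continuous f}.
Proof.
move=> oOm OmK Omx /(continuous_subspaceW OmK).
by rewrite continuous_open_subspace// => /(_ x); apply; exact: mem_set.
Qed.

(** Formally, Du = Dv / th at the maximum point, and subtracting the supersolution
    inequality for v1 from th times the subsolution inequality for u1 leaves the
    coupling terms and the sources.  The doubled variables make this rigorous:
    they give the inequality at points (x, y) near (x0, x0), up to errors that
    vanish as these points approach (x0, x0).  The term (c x - c y) (v1 - v2) y
    among them is controlled by the bound C. *)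
Lemma coupling_at_max (R : realType) (K Om : set (R * R)) (th C : R)
    (x0 : R * R) (c g u1 u2 v1 v2 : R * R -> R) :
  compact K -> open Om -> Om `<=` K -> Om x0 -> 0 < th ->
  {within K, continuous c} -> {within K, continuous g} ->
  (forall x, K x -> 0 < c x) -> (forall x, K x -> `|v1 x - v2 x| <= C) ->
  usc_within K u1 -> usc_within K u2 ->
  usc_within K (fun x => - v1 x) -> usc_within K (fun x => - v2 x) ->
  eikonal_sub Om (fun x => g x - c x * (u1 x - u2 x)) u1 ->
  eikonal_super Om (fun x => g x - c x * (v1 x - v2 x)) v1 ->
  (forall x, K x -> th * u1 x - v1 x <= th * u1 x0 - v1 x0) ->
  c x0 * ((th * u1 x0 - v1 x0) - (th * u2 x0 - v2 x0)) + (1 - th) * g x0 <= 0.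
Proof.
move=> cK oOm OmK Omx0 th0 cc cg c0 vC uu1 uu2 lv1 lv2 sub super max0.
have Kx0 := OmK _ Omx0.
set M := th * u1 x0 - v1 x0; set m := th * u2 x0 - v2 x0.
rewrite leNgt; apply/negP => E0.
(* The slack left to the semicontinuous term th u2 - v2: half of what the
   contradicted inequality fails by, measured in units of c (x0). *)
pose eta := (c x0 * (M - m) + (1 - th) * g x0) / (2 * c x0).
have eta0 : 0 < eta by rewrite divr_gt0// mulr_gt0// c0.
pose dev (x : R * R) := `|x.1 - x0.1| + `|x.2 - x0.2|.
(* Subtracting the two viscosity inequalities at the doubled points shows
   gap <= 0 there, whereas gap is continuous and positive at (x0, x0). *)
pose gap (z : (R * R) * (R * R)) :=
  c z.1 * (M - m - eta) - `|c z.1 - c z.2| * C + g z.2 - th * g z.1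
    - 2 * th * dev z.1.
have gap0 : 0 < gap (x0, x0).
  rewrite /gap /dev /= !subrr normr0 mul0r subr0 addr0 mulr0 subr0.
  rewrite (_ : _ - _ = (c x0 * (M - m) + (1 - th) * g x0) / 2) ?divr_gt0//.
  by rewrite /eta; field; rewrite gt_eqF ?c0.
have c_at := within_open_continuous _ _ _ _ oOm OmK Omx0 cc.
have g_at := within_open_continuous _ _ _ _ oOm OmK Omx0 cg.
have fst_at (h : R * R -> R) : {for x0, continuous h} ->
    h z.1 @[z --> (x0, x0)] --> h x0.
  by move=> ch; apply: (cvg_comp fst h _ ch); exact: (fst_continuous _ _ (x0, x0)).
have snd_at (h : R * R -> R) : {for x0, continuous h} ->
    h z.2 @[z --> (x0, x0)] --> h x0.
  by move=> ch; apply: (cvg_comp snd h _ ch); exact: (snd_continuous _ _ (x0, x0)).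
have dev_at : {for x0, continuous dev}.
  apply: cvgD; apply: cvg_norm; apply: cvgB; try exact: cvg_cst.
    exact: fst_continuous.
  exact: snd_continuous.
have gap_at : {for (x0, x0), continuous gap}.
  apply: cvgB; last by apply: cvgM; [exact: cvg_cst|exact: fst_at].
  apply: cvgB; last by apply: cvgM; [exact: cvg_cst|exact: fst_at].
  apply: cvgD; last exact: snd_at.
  apply: cvgB; (apply: cvgM; last exact: cvg_cst); first exact: fst_at.
  by apply: cvg_norm; apply: cvgB; [exact: fst_at|exact: snd_at].
pose s z := th * u2 z.1 + - v2 z.2.
have us : usc_within (K `*` K) s.
  apply: usc_withinD.
    apply: usc_withinZ => //.
    by apply: (usc_within_comp _ K fst u2) => // [|z []//]; exact: fst_continuous.
  by apply: (usc_within_comp _ K snd (fun x => - v2 x)) => // [|z []//];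
    exact: snd_continuous.
have near0 : \forall z \near (x0, x0),
    0 < gap z /\ ((K `*` K) z -> s z < m + eta).
  near=> z; split; near: z; first exact: (gap_at _ (lt_nbhsr gap0)).
  by apply: us; [split|rewrite /s ltrDl].
have lv1th : usc_within K (fun x => - (v1 x / th)).
  rewrite (_ : (fun _ => _) = fun x => th^-1 * - v1 x).
    by apply: usc_withinZ => //; rewrite invr_gt0.
  by apply/funext => x; rewrite mulrN mulrC.
have thE x : u1 x - v1 x / th = (th * u1 x - v1 x) / th.
  by field; rewrite gt_eqF.
have max0' x : K x -> u1 x - v1 x / th <= u1 x0 - v1 x0 / th.
  by move=> Kx; rewrite !thE ler_pM2r ?invr_gt0// max0.
have [n [x [y [[[Omx Omy] [gapxy sxy] Mxy] [maxx miny]]]]] :=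
  doubling_variables _ _ _ _ _ _ _ cK oOm OmK Omx0 uu1 lv1th max0' near0.
have Kx := OmK _ Omx; have Ky := OmK _ Omy.
have {maxx}subx := sub _ (C1_on_quad _ _ _ _ _ _) _ Omx maxx.
(* Multiplying by th turns the test of v1 / th into one of v1. *)
have miny' : local_min (fun z => v1 z - quad (- (th * n)) x 0 x z) y.
  apply: filterS miny => z; rewrite /quad !mul0r !addr0 => h.
  have := ler_wpM2l (ltW th0) h.
  rewrite !mulrBr ![th * (v1 _ / th)]mulrC !divfK ?gt_eqF//.
  lra.
have supery := super _ (C1_on_quad _ _ _ _ _ _) _ Omy miny'.
have := le_trans supery (grad_norm_quad_le _ _ _ _ _ x0 (ltW th0)).
have {}sxy := sxy (conj Kx Ky).
have {}Mxy : M <= th * u1 x - v1 y.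
  have := ler_wpM2l (ltW th0) Mxy.
  by rewrite !mulrBr ![th * (v1 _ / th)]mulrC !divfK ?gt_eqF.
move: gapxy; rewrite /gap /s /= in sxy *; rewrite -/(dev x).
have h1 : c x * (M - m - eta) <= c x * (th * u1 x - v1 y - (th * u2 x + - v2 y)).
  by rewrite ler_pM2l ?c0//; lra.
have h2 : (c y - c x) * (v1 y - v2 y) <= `|c x - c y| * C.
  apply: le_trans (ler_norm _) _; rewrite normrM distrC.
  by rewrite ler_wpM2l ?vC.
have := ler_wpM2l (ltW th0) subx.
lra.
Unshelve. all: by end_near. Qed.

(** For w1 both terms of [coupling_at_max] are nonnegative, so both vanish: g1 is
    zero at x0 and w2 takes the same value there.  Hence x0 is a maximum point of
    w2 as well, and the inequality for the second equation reduces to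
    (1 - th) g2 (x0) <= 0. *)
Lemma sources_vanish_at_max (R : realType) (K Om : set (R * R)) (th C : R)
    (x0 : R * R) (c1 c2 g1 g2 u1 u2 v1 v2 : R * R -> R) :
  compact K -> open Om -> Om `<=` K -> Om x0 -> 0 < th -> th < 1 ->
  {within K, continuous c1} -> {within K, continuous c2} ->
  {within K, continuous g1} -> {within K, continuous g2} ->
  (forall x, K x -> 0 < c1 x) -> (forall x, K x -> 0 < c2 x) ->
  (forall x, K x -> 0 <= g1 x) -> (forall x, K x -> 0 <= g2 x) ->
  (forall x, K x -> `|v1 x - v2 x| <= C) ->
  usc_within K u1 -> usc_within K u2 ->
  usc_within K (fun x => - v1 x) -> usc_within K (fun x => - v2 x) ->
  eikonal_sub Om (fun x => g1 x - c1 x * (u1 x - u2 x)) u1 ->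
  eikonal_sub Om (fun x => g2 x - c2 x * (u2 x - u1 x)) u2 ->
  eikonal_super Om (fun x => g1 x - c1 x * (v1 x - v2 x)) v1 ->
  eikonal_super Om (fun x => g2 x - c2 x * (v2 x - v1 x)) v2 ->
  (forall x, K x -> th * u1 x - v1 x <= th * u1 x0 - v1 x0) ->
  (forall x, K x -> th * u2 x - v2 x <= th * u1 x0 - v1 x0) ->
  g1 x0 = 0 /\ g2 x0 = 0.
Proof.
move=> cK oOm OmK Omx0 th0 th1 cc1 cc2 cg1 cg2 c10 c20 g10 g20.
move=> vC uu1 uu2 lv1 lv2 sub1 sub2 sup1 sup2 max1 max2; have Kx0 := OmK _ Omx0.
have th1' : 0 < 1 - th by rewrite subr_gt0.
have := coupling_at_max _ _ _ _ _ _ _ _ _ _ _ _ cK oOm OmK Omx0 th0 cc1 cg1 c10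
  vC uu1 uu2 lv1 lv2 sub1 sup1 max1.
have cm : 0 <= c1 x0 * (th * u1 x0 - v1 x0 - (th * u2 x0 - v2 x0)).
  by rewrite mulr_ge0// ?subr_ge0 ?max2// ltW// c10.
have gm : 0 <= (1 - th) * g1 x0 by rewrite mulr_ge0// ?g10// ltW.
move=> le0.
have g1z : g1 x0 = 0.
  have /eqP : (1 - th) * g1 x0 = 0 by lra.
  by rewrite mulf_eq0 gt_eqF//= => /eqP.
have eqw : th * u1 x0 - v1 x0 = th * u2 x0 - v2 x0.
  have /eqP : c1 x0 * (th * u1 x0 - v1 x0 - (th * u2 x0 - v2 x0)) = 0 by lra.
  by rewrite mulf_eq0 gt_eqF ?c10//= subr_eq0 => /eqP.
split=> //.
have vC' x : K x -> `|v2 x - v1 x| <= C by rewrite distrC; exact: vC.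
have max2' x : K x -> th * u2 x - v2 x <= th * u2 x0 - v2 x0.
  by rewrite -eqw; exact: max2.
have := coupling_at_max _ _ _ _ _ _ _ _ _ _ _ _ cK oOm OmK Omx0 th0 cc2 cg2 c20
  vC' uu2 uu1 lv2 lv1 sub2 sup2 max2'.
rewrite eqw subrr mulr0 add0r => h; apply/eqP.
by rewrite eq_le g20// andbT -(pmulr_rle0 _ th1').
Qed.

(** * The rectangle *)

Lemma open_rect_open (R : realType) (L S : R) : open (open_rect L S).
Proof.
have -> : open_rect L S = fst @^-1` `]0, L[%classic `&` snd @^-1` `]0, S[%classic.
  by [].
by apply: openI; apply: open_comp => [x _|];
  do ?[exact: fst_continuous|exact: snd_continuous|exact: itv_open].
Qed.

Lemma open_rect_sub (R : realType) (L S : R) : open_rect L S `<=` closed_rect L S.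
Proof.
move=> x []; rewrite /closed_rect/= !in_itv/=.
by move=> /andP[/ltW-> /ltW->] /andP[/ltW-> /ltW->].
Qed.

Lemma closed_rect_compact (R : realType) (L S : R) : compact (closed_rect L S).
Proof. by apply: compact_setX; exact: segment_compact. Qed.

(** A point of the closed rectangle is in the closure of the open one because the
    segment towards the centre enters the open rectangle at once. *)
Lemma closed_rect_split (R : realType) (L S : R) (x : R * R) : 0 < L -> 0 < S ->
  closed_rect L S x -> open_rect L S x \/ boundary (open_rect L S) x.
Proof.
move=> L0 S0 Kx; have [Ox|nOx] := pselect (open_rect L S x); [by left|right].
split; last by move=> /interior_subset.
move=> B Bx.
pose h (t : R) : R * R := (x.1 + t * (L / 2 - x.1), x.2 + t * (S / 2 - x.2)).
have h0 : h 0 = x by rewrite /h !mul0r !addr0 -surjective_pairing.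
have hc : h t @[t --> 0^'+] --> h 0.
  apply: cvg_at_right_filter.
  have lin (a b : R) : a + t * b @[t --> (0 : R)] --> a + 0 * b.
    by apply: cvgD; [exact: cvg_cst|apply: cvgM; [exact: cvg_id|exact: cvg_cst]].
  exact: (cvg_pair (lin _ _) (lin _ _)).
rewrite h0 in hc.
have : \forall t \near 0^'+, [/\ 0 < t, t < 1 & B (h t)].
  near=> t; split; near: t; [exact: nbhs_right_gt|exact: nbhs_right_lt|exact: hc].
move=> /filter_ex[t [t0 t1 Bh]]; exists (h t); split=> //.
have [] := Kx; rewrite /open_rect/= !in_itv/= => /andP[a0 aL] /andP[b0 bS].
have inner (l a : R) : 0 < l -> 0 <= a -> a <= l ->
    0 < a + t * (l / 2 - a) < l.
  move=> l0 ha hl.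
  have p1 : 0 < t * l by rewrite mulr_gt0.
  have p2 : 0 <= (1 - t) * a by rewrite mulr_ge0// subr_ge0 ltW.
  have p3 : 0 <= (1 - t) * (l - a) by rewrite mulr_ge0// subr_ge0// ltW.
  by apply/andP; split; nra.
by split; rewrite /= ?in_itv/=; apply: inner.
Unshelve. all: by end_near. Qed.

(** * The comparison principle *)

Theorem theorem1 (R : realType) (L S : R)
    (phi1 phi2 lambda rho K1 K2 f1 f2 u1 u2 v1 v2 : R * R -> R)
    (L_gt0 : 0 < L) (S_gt0 : 0 < S)
    (phi1_cont : {within closed_rect L S, continuous phi1})
    (phi2_cont : {within closed_rect L S, continuous phi2})
    (lambda_cont : {within closed_rect L S, continuous lambda})
    (rho_cont : {within closed_rect L S, continuous rho})
    (K1_cont : {within closed_rect L S, continuous K1})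
    (K2_cont : {within closed_rect L S, continuous K2})
    (f1_cont : {within closed_rect L S, continuous f1})
    (f2_cont : {within closed_rect L S, continuous f2})
    (phi1_gt0 : forall x, closed_rect L S x -> 0 < phi1 x)
    (phi2_gt0 : forall x, closed_rect L S x -> 0 < phi2 x)
    (lambda_ge0 : forall x, closed_rect L S x -> 0 <= lambda x)
    (rho_ge0 : forall x, closed_rect L S x -> 0 <= rho x)
    (K1_ge0 : forall x, closed_rect L S x -> 0 <= K1 x)
    (K2_ge0 : forall x, closed_rect L S x -> 0 <= K2 x)
    (f1_gt0 : forall x, closed_rect L S x -> 0 < f1 x)
    (f2_gt0 : forall x, closed_rect L S x -> 0 < f2 x)
    (u1_bounded : [bounded u1 x | x in closed_rect L S])
    (u2_bounded : [bounded u2 x | x in closed_rect L S])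
    (u1_usc : usc_on (closed_rect L S) u1)
    (u2_usc : usc_on (closed_rect L S) u2)
    (u_sub : viscosity_subsolution (open_rect L S)
       f1 f2 phi1 phi2 lambda rho K1 K2 u1 u2)
    (v1_bounded : [bounded v1 x | x in closed_rect L S])
    (v2_bounded : [bounded v2 x | x in closed_rect L S])
    (v1_lsc : lsc_on (closed_rect L S) v1)
    (v2_lsc : lsc_on (closed_rect L S) v2)
    (v_super : viscosity_supersolution (open_rect L S)
       f1 f2 phi1 phi2 lambda rho K1 K2 v1 v2)
    (uv_le : forall x,
       (aubry_set (closed_rect L S) phi2 lambda rho K1 K2
        `|` boundary (open_rect L S)) x ->
       u1 x <= v1 x /\ u2 x <= v2 x) :
  forall x, closed_rect L S x -> u1 x <= v1 x /\ u2 x <= v2 x.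
Proof.
pose K := closed_rect L S; pose Om := open_rect L S.
have cK : compact K by exact: closed_rect_compact.
have oOm : open Om by exact: open_rect_open.
have OmK : Om `<=` K by exact: open_rect_sub.
have [C1 C10 uC1] := ex_strict_bound_gt0 u1_bounded.
have [C2 C20 uC2] := ex_strict_bound_gt0 u2_bounded.
have [E1 E10 vE1] := ex_strict_bound_gt0 v1_bounded.
have [E2 E20 vE2] := ex_strict_bound_gt0 v2_bounded.
have vE x : K x -> `|v1 x - v2 x| <= E1 + E2.
  move=> Kx; apply: le_trans (ler_normB _ _) _.
  by rewrite lerD// ltW//; [exact: vE1|exact: vE2].
have uu1 := usc_on_within _ _ _ u1_usc; have uu2 := usc_on_within _ _ _ u2_usc.
have lv1 := lsc_on_within _ _ _ v1_lsc; have lv2 := lsc_on_within _ _ _ v2_lsc.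
pose h1 x := K1 x + lambda x * rho x; pose h2 x := K2 x + phi2 x * rho x.
have f1Om x : Om x -> 0 < f1 x by move=> /OmK /f1_gt0.
have f2Om x : Om x -> 0 < f2 x by move=> /OmK /f2_gt0.
have [_ _ sub1 sub2] := u_sub; have [_ _ sup1 sup2] := v_super.
have {}sub1 := eikonal_sub_normalized _ _ f1 phi1 h1 u1 u2 f1Om sub1.
have {}sub2 := eikonal_sub_normalized _ _ f2 phi2 h2 u2 u1 f2Om sub2.
have {}sup1 := eikonal_super_normalized _ _ f1 phi1 h1 v1 v2 f1Om sup1.
have {}sup2 := eikonal_super_normalized _ _ f2 phi2 h2 v2 v1 f2Om sup2.
have ch1 : {within K, continuous h1}.
  by apply: within_continuousD => //; exact: within_continuousM.
have ch2 : {within K, continuous h2}.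
  by apply: within_continuousD => //; exact: within_continuousM.
have h1_ge0 x : K x -> 0 <= h1 x.
  by move=> Kx; rewrite addr_ge0 ?K1_ge0// mulr_ge0 ?lambda_ge0 ?rho_ge0.
have h2_ge0 x : K x -> 0 <= h2 x.
  by move=> Kx; rewrite addr_ge0 ?K2_ge0// mulr_ge0 ?rho_ge0// ltW ?phi2_gt0.
have cg1 := within_continuous_div _ _ _ _ ch1 f1_cont f1_gt0.
have cg2 := within_continuous_div _ _ _ _ ch2 f2_cont f2_gt0.
have cc1 := within_continuous_div _ _ _ _ phi1_cont f1_cont f1_gt0.
have cc2 := within_continuous_div _ _ _ _ phi2_cont f2_cont f2_gt0.
have g1_ge0 x : K x -> 0 <= h1 x / f1 x.
  by move=> Kx; rewrite divr_ge0 ?h1_ge0// ltW// f1_gt0.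
have g2_ge0 x : K x -> 0 <= h2 x / f2 x.
  by move=> Kx; rewrite divr_ge0 ?h2_ge0// ltW// f2_gt0.
have c1_gt0 x : K x -> 0 < phi1 x / f1 x.
  by move=> Kx; rewrite divr_gt0 ?phi1_gt0 ?f1_gt0.
have c2_gt0 x : K x -> 0 < phi2 x / f2 x.
  by move=> Kx; rewrite divr_gt0 ?phi2_gt0 ?f2_gt0.
have in_aubry x : K x -> h1 x / f1 x = 0 -> h2 x / f2 x = 0 ->
    u1 x <= v1 x /\ u2 x <= v2 x.
  move=> Kx /eqP; rewrite mulf_eq0 invr_eq0 (gt_eqF (f1_gt0 _ Kx)) orbF.
  move=> /eqP h10 /eqP; rewrite mulf_eq0 invr_eq0 (gt_eqF (f2_gt0 _ Kx)) orbF.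
  move=> /eqP h20.
  by apply: uv_le; left.
move=> x Kx.
suff main : ~ (exists2 D, 0 < D & D <= u1 x - v1 x \/ D <= u2 x - v2 x).
  split; rewrite leNgt; apply/negP => lt_vu; apply: main.
    by exists (u1 x - v1 x); [rewrite subr_gt0|left].
  by exists (u2 x - v2 x); [rewrite subr_gt0|right].
move=> [D D0 Dx].
pose C := C1 + C2.
have C0 : 0 < C by rewrite addr_gt0.
have uC i : K i -> - C <= u1 i <= C /\ - C <= u2 i <= C.
  move=> Ki; rewrite -!ler_norml; split.
    by apply: le_trans (ltW (uC1 _ Ki)) _; rewrite lerDl ltW.
  by apply: le_trans (ltW (uC2 _ Ki)) _; rewrite lerDr ltW.
(* Any e in (0, 1) with 2 e C < D serves: e C is the most by which replacing u
   by (1 - e) u moves w, both where u <= v and where u exceeds v by D. *)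
pose e := D / (4 * C + D).
have CD0 : 0 < 4 * C + D by lra.
have e0 : 0 < e by rewrite divr_gt0.
have e1 : e < 1 by rewrite ltr_pdivrMr// mul1r; lra.
have eC : 2 * (e * C) < D.
  by rewrite /e mulrAC mulrA ltr_pdivrMr//; nra.
pose th := 1 - e.
have th0 : 0 < th by rewrite subr_gt0.
have th1 : th < 1 by rewrite gtrBl.
have close y a : - C <= a <= C -> a - y - e * C <= th * a - y <= a - y + e * C.
  move=> /andP[aC Ca]; rewrite /th; apply/andP; split; nra.
have K0 : K !=set0 by exists x.
have uw1 : usc_within K (fun y => th * u1 y + - v1 y).
  by apply: usc_withinD => //; exact: usc_withinZ.
have uw2 : usc_within K (fun y => th * u2 y + - v2 y).
  by apply: usc_withinD => //; exact: usc_withinZ.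
have [a Ka maxa] := usc_within_max _ _ K0 cK uw1.
have [b Kb maxb] := usc_within_max _ _ K0 cK uw2.
(* The component with the larger maximum plays the part of the first one. *)
have [le_ba|/ltW le_ab] := leP (th * u2 b - v2 b) (th * u1 a - v1 a).
- have max2 y : K y -> th * u2 y - v2 y <= th * u1 a - v1 a.
    by move=> /maxb /le_trans; exact.
  have big : e * C < th * u1 a - v1 a.
    have [/close - /(_ (v1 x))/andP[w1 _] /close - /(_ (v2 x))/andP[w2 _]] := uC _ Kx.
    by have := maxa x Kx; have := max2 x Kx; case: Dx; lra.
  suff : u1 a <= v1 a.
    have [/close - /(_ (v1 a))/andP[_ w1] _] := uC _ Ka; lra.
  have [Oma|ba] := closed_rect_split _ _ _ _ L_gt0 S_gt0 Ka; last first.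
    by have [] := uv_le a (or_intror ba).
  have [g10 g20] := sources_vanish_at_max _ _ _ _ _ _ _ _ _ _ _ _ _ _
    cK oOm OmK Oma th0 th1 cc1 cc2 cg1 cg2 c1_gt0 c2_gt0 g1_ge0 g2_ge0 vE
    uu1 uu2 lv1 lv2 sub1 sub2 sup1 sup2 maxa max2.
  by have [] := in_aubry a Ka g10 g20.
- have max1 y : K y -> th * u1 y - v1 y <= th * u2 b - v2 b.
    by move=> /maxa /le_trans; exact.
  have big : e * C < th * u2 b - v2 b.
    have [/close - /(_ (v1 x))/andP[w1 _] /close - /(_ (v2 x))/andP[w2 _]] := uC _ Kx.
    by have := maxb x Kx; have := max1 x Kx; case: Dx; lra.
  suff : u2 b <= v2 b.
    have [_ /close - /(_ (v2 b))/andP[_ w2]] := uC _ Kb; lra.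
  have [Omb|bb] := closed_rect_split _ _ _ _ L_gt0 S_gt0 Kb; last first.
    by have [] := uv_le b (or_intror bb).
  have vE' y : K y -> `|v2 y - v1 y| <= E1 + E2 by rewrite distrC; exact: vE.
  have [g20 g10] := sources_vanish_at_max _ _ _ _ _ _ _ _ _ _ _ _ _ _
    cK oOm OmK Omb th0 th1 cc2 cc1 cg2 cg1 c2_gt0 c1_gt0 g2_ge0 g1_ge0 vE'
    uu2 uu1 lv2 lv1 sub2 sub1 sup2 sup1 maxb max1.
  by have [] := in_aubry b Kb g10 g20.
Qed.
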